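(* Let $I,J\in\mathrm{Int}(n)$. Then $I\sim_D J$ if and only if there exist a nonnegative integer $r$ and indices $i_1,\dots,i_r\in[n-1]$ such that $P_J=s_{i_r}\cdots s_{i_2}s_{i_1}\cdot P_I$ and, for every $1\le k\le r$, $(i_k,i_k+1)$ is a comparable pair that is not in the covering relation (i.e. $i_k$ and $i_k+1$ are comparable but neither covers the other) in the poset $s_{i_{k-1}}\cdots s_{i_2}s_{i_1}\cdot P_I$.
   Context: $n$ is a positive integer, $[n]=\{1,\dots,n\}$, $\mathfrak S_n$ is the symmetric group on $[n]$ (product = composition of maps), $s_i=(i,i+1)$, $\ell$ is Coxeter length. $\mathrm{Des}_L(\sigma)=\{i\in[n-1]:\ell(s_i\sigma)<\ell(\sigma)\}$. The left weak Bruhat order $\preceq_L$ on $\mathfrak S_n$ has covering relations $\sigma\prec s_i\sigma$ for $i\notin \mathrm{Des}_L(\sigma)$; $[\sigma,\rho]_L=\{\gamma:\sigma\preceq_L\gamma\preceq_L\rho\}$. $\mathrm{Int}(n)$ is the set of nonempty left weak Bruhat intervals $[\sigma,\rho]_L$ in $\mathfrak S_n$. For $I_1,I_2\in \mathrm{Int}(n)$, $I_1\sim_D I_2$ means that there is a poset isomorphism $f:(I_1,\preceq_L)\to(I_2,\preceq_L)$ with $\mathrm{Des}_L(\gamma)=\mathrm{Des}_L(f(\gamma))$ for all $\gamma\in I_1$. $\mathsf P_n$ is the set of posets with ground set $[n]$. For $P\in\mathsf P_n$, $\Sigma_L(P)=\{\sigma\in\mathfrak S_n:\sigma(i)\le\sigma(j)\text{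 for all } i,j\in[n]\text{ with } i\preceq_P j\}$. A poset $P\in\mathsf P_n$ is regular if for all $x,y,z\in[n]$ with $x\preceq_P z$: if $x<y<z$ or $z<y<x$, then $x\preceq_P y$ or $y\preceq_P z$. By a theorem of Björner–Wachs, $P\mapsto\Sigma_L(P)$ is a bijection from regular posets in $\mathsf P_n$ to $\mathrm{Int}(n)$; for $I\in\mathrm{Int}(n)$, $P_I$ is the regular poset with $\Sigma_L(P_I)=I$. $\mathfrak S_n$ acts on $\mathsf P_n$ by relabeling: $\sigma(a)\preceq_{\sigma\cdot P}\sigma(b)$ iff $a\preceq_P b$; thus $s_i\cdot P$ is obtained from $P$ by interchanging the labels $i$ and $i+1$. *)

(* Defs.v *)
From HB Require Import structures.
From mathcomp Require Import all_boot fingroup perm.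

Set Implicit Arguments.
Unset Strict Implicit.
Unset Printing Implicit Defensive.

Local Open Scope group_scope.

(* The ground set {1, ..., n} is 'I_n = {0, ..., n - 1} and the index set
   {1, ..., n - 1} is 'I_n.-1 = {0, ..., n - 2}: everything is shifted by one. *)

Lemma letter_hi_subproof n (i : 'I_n.-1) : i.+1 < n.
Proof. by case: n i => [|n] [i /=]. Qed.

Definition letter_lo n (i : 'I_n.-1) : 'I_n := widen_ord (leq_pred n) i.
Definition letter_hi n (i : 'I_n.-1) : 'I_n := Ordinal (letter_hi_subproof i).

Definition simple_refl n (i : 'I_n.-1) : {perm 'I_n} :=
  tperm (letter_lo i) (letter_hi i).

(* In MathComp (s * t) x = t (s x), whereas here products are compositions. *)
Definition pcomp n (s t : {perm 'I_n}) : {perm 'I_n} := t * s.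

(* word_perm [:: i_1; ...; i_r] is the composition s_{i_r} o ... o s_{i_1}. *)
Definition word_perm n (w : seq 'I_n.-1) : {perm 'I_n} :=
  foldl (fun s i => pcomp (simple_refl i) s) 1 w.

Lemma word_perm_prod n (w : seq 'I_n.-1) :
  word_perm w = \prod_(i <- w) simple_refl i.
Proof.
elim/last_ind: w => [|w i IHw]; first by rewrite big_nil.
by rewrite /word_perm foldl_rcons -/(word_perm w) IHw -cats1 big_cat big_seq1.
Qed.

Definition has_word n (s : {perm 'I_n}) (k : nat) : bool :=
  [exists w : k.-tuple 'I_n.-1, word_perm w == s].

Lemma has_wordP n (s : {perm 'I_n}) :
  (exists k, has_word s k) <-> (exists w, s = word_perm w).
Proof.
split=> [[k /existsP[w /eqP <-]]|[w ->]]; first by exists w.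
by exists (size w); apply/existsP; exists (in_tuple w).
Qed.

Lemma has_word_exists n (s : {perm 'I_n}) : exists k, has_word s k.
Proof.
apply/has_wordP.
pose G (t : {perm 'I_n}) := exists w, t = \prod_(i <- w) simple_refl i.
have GM t u : G t -> G u -> G (t * u).
  by move=> [w ->] [w' ->]; exists (w ++ w'); rewrite big_cat.
have G1 : G 1 by exists [::]; rewrite big_nil.
have Gs i : G (simple_refl i) by exists [:: i]; rewrite big_seq1.
have Glt d (x y : 'I_n) : y = x + d :> nat -> G (tperm x y).
  elim: d x y => [|d IHd] x y.
    by rewrite addn0 => /esym/val_inj ->; rewrite tperm1.
  move=> Ey; have ltyn : (x + d).+1 < n by rewrite -addnS -Ey.
  have lti : x + d < n.-1 by rewrite ltn_predRL.
  pose i := Ordinal lti; have Eyi : y = letter_hi i.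
    by apply/val_inj; rewrite /= Ey addnS.
  have [d0|d_gt0] := posnP d.
    have -> : x = letter_lo i by apply/val_inj; rewrite /= d0 addn0.
    by rewrite Eyi; exact: Gs.
  have -> : tperm x y = tperm x (letter_lo i) ^ simple_refl i.
    rewrite tpermJ tpermL -Eyi tpermD // -val_eqE /=.
      by rewrite -[X in _ != X]addn0 eqn_add2l -lt0n.
    by rewrite -addnS -[X in _ != X]addn0 eqn_add2l.
  have -> t : t ^ simple_refl i = simple_refl i * (t * simple_refl i).
    by rewrite /conjg tpermV mulgA.
  by apply/GM/GM/Gs => //; apply: IHd.
have Gtperm x y : G (tperm x y).
  have [le_xy|/ltnW le_yx] := leqP x y.
    by apply: (Glt (y - x)); rewrite subnKC.
  by rewrite tpermC; apply: (Glt (x - y)); rewrite subnKC.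
have [ts -> _] := prod_tpermP s.
have [w ->] : G (\prod_(t <- ts) tperm t.1 t.2).
  by elim: ts => [|t ts IHts]; rewrite ?big_nil // big_cons; apply: GM.
by exists w; rewrite word_perm_prod.
Qed.

Definition coxeter_length n (s : {perm 'I_n}) : nat :=
  ex_minn (has_word_exists s).

Definition DesL n (s : {perm 'I_n}) : {set 'I_n.-1} :=
  [set i | coxeter_length (pcomp (simple_refl i) s) < coxeter_length s].

Definition weakL_cover n (s t : {perm 'I_n}) : bool :=
  [exists i, (i \notin DesL s) && (t == pcomp (simple_refl i) s)].

Definition weakL n (s t : {perm 'I_n}) : bool := connect (@weakL_cover n) s t.

Definition weak_interval n (s t : {perm 'I_n}) : {set {perm 'I_n}} :=
  [set u | weakL s u && weakL u t].

Definition Int n : {set {set {perm 'I_n}}} :=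
  [set I | (I != set0) && [exists s, exists t, I == weak_interval s t]].

(* Only the values of f on I matter. *)
Definition descent_equiv n (I J : {set {perm 'I_n}}) : Prop :=
  exists f : {perm 'I_n} -> {perm 'I_n},
    [/\ {in I &, injective f}, f @: I = J,
        {in I &, {mono f : s t / weakL s t}} &
        {in I, forall s, DesL s = DesL (f s)}].

Definition is_porder n (S : {set 'I_n * 'I_n}) : bool :=
  [&& [forall x, (x, x) \in S],
      [forall x, forall y, ((x, y) \in S) && ((y, x) \in S) ==> (x == y)] &
      [forall x, forall y, forall z,
         ((x, y) \in S) && ((y, z) \in S) ==> ((x, z) \in S)]].

(* Posets on a fixed ground set are represented by the graph of their order
   relation, so that Leibniz equality is equality of labeled posets. *)
Record labposet n := LabPoset {
  graph_of :> {set 'I_n * 'I_n};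
  _ : is_porder graph_of }.

HB.instance Definition _ n := [isSub for @graph_of n].
HB.instance Definition _ n := [Finite of labposet n by <:].

Definition ple n (P : labposet n) (x y : 'I_n) : bool := (x, y) \in graph_of P.
Definition plt n (P : labposet n) (x y : 'I_n) : bool := (x != y) && ple P x y.

Definition pcomparable n (P : labposet n) (x y : 'I_n) : bool :=
  ple P x y || ple P y x.

Definition pcovers n (P : labposet n) (x y : 'I_n) : bool :=
  plt P x y && ~~ [exists z, plt P x z && plt P z y].

Definition comparable_noncover n (P : labposet n) (x y : 'I_n) : bool :=
  [&& pcomparable P x y, ~~ pcovers P x y & ~~ pcovers P y x].

Definition SigmaL n (P : labposet n) : {set {perm 'I_n}} :=
  [set s : {perm 'I_n} | [forall i, forall j, ple P i j ==> (s i <= s j)]].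

Definition regular n (P : labposet n) : bool :=
  [forall x : 'I_n, forall y : 'I_n, forall z : 'I_n,
     [&& ple P x z & (x < y < z) || (z < y < x)] ==> ple P x y || ple P y z].

Lemma is_porder_diag n : is_porder [set p : 'I_n * 'I_n | p.1 == p.2].
Proof.
apply/and3P; split.
- by apply/forallP=> x; rewrite inE /=.
- by apply/'forall_forallP=> x y; rewrite !inE /=; apply/implyP=> /andP[].
apply/forallP=> x; apply/'forall_forallP=> y z; rewrite !inE /=.
by apply/implyP=> /andP[/eqP -> ].
Qed.

Definition antichain n : labposet n := LabPoset (is_porder_diag n).

(* By the Bjorner-Wachs theorem, for I in Int n exactly one regular poset P
   satisfies SigmaL P = I, so the default value antichain is never used. *)
Definition poset_of_interval n (I : {set {perm 'I_n}}) : labposet n :=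
  odflt (antichain n) [pick P | regular P & SigmaL P == I].

Lemma is_porder_relabel n (s : {perm 'I_n}) (P : labposet n) :
  is_porder [set p : 'I_n * 'I_n | ple P (s^-1 p.1) (s^-1 p.2)].
Proof.
rewrite /ple; case: P => S /= /and3P[/forallP Sr /'forall_forallP Sa Strans].
apply/and3P; split.
- by apply/forallP=> x; rewrite inE.
- apply/'forall_forallP=> x y; rewrite !inE /=; apply/implyP=> Sxy.
  by move/implyP: (Sa (s^-1 x) (s^-1 y)) => /(_ Sxy); rewrite (inj_eq perm_inj).
apply/forallP=> x; apply/'forall_forallP=> y z; rewrite !inE /=.
by move/forallP/(_ (s^-1 x))/'forall_forallP: Strans.
Qed.

Definition relabel n (s : {perm 'I_n}) (P : labposet n) : labposet n :=
  LabPoset (is_porder_relabel s P).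

Lemma ple_relabel n (s : {perm 'I_n}) (P : labposet n) (a b : 'I_n) :
  ple (relabel s P) (s a) (s b) = ple P a b.
Proof. by rewrite {1}/ple inE /= !permK. Qed.

(* Main.v *)
Require Import Defs.
From mathcomp Require Import all_boot fingroup perm zify.

(* In inversion sets, the left weak order is inclusion and i is a left descent
   of s when i + 1 occurs before i in s^-1.  A descent-preserving isomorphism
   f : I -> J respects the labels of the cover relations, because passing from s
   to s_i s creates the single descent i; hence f is right translation by a
   fixed v^-1, and P_J = v . P_I since a poset is determined by its linear
   extensions.  Two labels a, b are adjacent values of some linear extension of
   P_I exactly when they are incomparable or one covers the other, and
   preservation of descents says that v keeps the order of such pairs.  So the
   inversions of v are comparable pairs that are not covers, and this persists
   while v is sorted by adjacent transpositions of labels.  Conversely, swapping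
   the labels j and j + 1 of such a pair moves no pair of adjacent values, so it
   preserves descents and inclusions of inversion sets. *)

Set Implicit Arguments.
Unset Strict Implicit.
Unset Printing Implicit Defensive.

Local Open Scope group_scope.

(** * Inversion sets, Coxeter length and the left weak order *)

Section Inversions.

Variable n : nat.
Implicit Types (s t u v : {perm 'I_n}) (i j : 'I_n.-1) (x y : 'I_n).

Lemma letter_lt i : letter_lo i < letter_hi i.
Proof. by rewrite /=. Qed.

Lemma letter_neq i : letter_lo i != letter_hi i.
Proof. by rewrite -val_eqE /= neq_ltn ltnSn. Qed.

Lemma simple_reflE i x :
  simple_refl i x = (if x == i :> nat then i.+1 else
                     if x == i.+1 :> nat then nat_of_ord i else x) :> nat.
Proof.
rewrite /simple_refl; case: tpermP => [->|->|ne_lo ne_hi] /=.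
- by rewrite eqxx.
- by rewrite gtn_eqF // eqxx.
by rewrite !ifN //; apply/eqP=> E; [case: ne_hi|case: ne_lo]; apply/val_inj.
Qed.

(** No letter lies strictly between [i] and [i.+1], so exchanging them affects only their comparison
    with each other. *)
Lemma simple_refl_lt i x y :
    (x, y) != (letter_lo i, letter_hi i) ->
    (x, y) != (letter_hi i, letter_lo i) ->
  (simple_refl i x < simple_refl i y) = (x < y).
Proof.
rewrite !xpair_eqE -!val_eqE /= !simple_reflE.
move: (nat_of_ord x) (nat_of_ord y) (nat_of_ord i) => a b k.
by case: (eqVneq a k); case: (eqVneq a k.+1); case: (eqVneq b k);
  case: (eqVneq b k.+1) => /=; lia.
Qed.

Lemma simple_reflL i : simple_refl i (letter_lo i) = letter_hi i.
Proof. exact: tpermL. Qed.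

Lemma simple_reflR i : simple_refl i (letter_hi i) = letter_lo i.
Proof. exact: tpermR. Qed.

Lemma simple_reflK s i : s * simple_refl i * simple_refl i = s.
Proof. by rewrite -mulgA tperm2 mulg1. Qed.

Lemma simple_reflV i : (simple_refl i)^-1 = simple_refl i.
Proof. exact: tpermV. Qed.

(** Such an [s] and its inverse are strictly monotone, so neither moves a point down. This ends
    every sorting argument below: without descents only the identity is left. *)
Lemma perm_increasing s :
  (forall i, s (letter_lo i) < s (letter_hi i)) -> s = 1.
Proof.
move=> s_incr.
have s_lt d x y : y = x + d.+1 :> nat -> s x < s y.
  elim: d y => [|d IHd] y Ey.
    have lti : x < n.-1 by have := ltn_ord y; lia.
    have := s_incr (Ordinal lti).
    by congr (s _ < s _); apply/val_inj; rewrite /= ?Ey ?addn1.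
  have lti : x + d.+1 < n.-1 by have := ltn_ord y; lia.
  have -> : y = letter_hi (Ordinal lti) by apply/val_inj; rewrite /= Ey addnS.
  by apply: ltn_trans (s_incr _); apply: IHd.
have s_mono x y : (s x < s y) = (x < y).
  case: (ltngtP x y) => [lt_xy|lt_yx|/val_inj->]; last by rewrite ltnn.
    by apply: (s_lt (y - x).-1); lia.
  by apply/negbTE; rewrite -leqNgt ltnW // (s_lt (x - y).-1) //; lia.
have le_incr t : {mono t : x y / x < y} -> forall x, x <= t x.
  move=> t_mono [m ltm] /=; elim: m ltm => // m IHm ltm.
  apply: leq_ltn_trans (IHm (ltnW ltm)) _.
  by rewrite t_mono.
apply/permP=> x; rewrite perm1; apply/val_inj/eqP; rewrite eqn_leq le_incr // andbT.
have sV_mono : {mono s^-1 : x y / x < y} by move=> y z; rewrite -s_mono !permKV.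
by rewrite -{2}[x](permK s) le_incr.
Qed.

(** Inversions are recorded by positions rather than values: [s * simple_refl i] exchanges two
    values, so positions stay fixed along the left weak order. *)
Definition inversions s : {set 'I_n * 'I_n} :=
  [set p : 'I_n * 'I_n | (p.1 < p.2) && (s p.2 < s p.1)].

Lemma mem_inversions s x y : ((x, y) \in inversions s) = (x < y) && (s y < s x).
Proof. by rewrite inE. Qed.

Lemma inversions1 : inversions 1 = set0.
Proof.
apply/setP=> -[x y]; rewrite mem_inversions !perm1 inE.
by case: ltngtP.
Qed.

(** In one-line notation, the value [i] stands to the left of [i.+1]; [in_DesL] identifies the
    negation with a left descent. *)
Definition ascent s i := s^-1 (letter_lo i) < s^-1 (letter_hi i).

Lemma ascent_mul s i : ascent (s * simple_refl i) i = ~~ ascent s i.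
Proof.
rewrite /ascent invMg simple_reflV !permM simple_reflL simple_reflR.
rewrite -leqNgt [RHS]leq_eqVlt; case: eqP => // /val_inj /perm_inj /eqP.
by rewrite eq_sym (negPf (letter_neq i)).
Qed.

Definition ascent_pair s i := (s^-1 (letter_lo i), s^-1 (letter_hi i)).

Lemma ascent_pairN s i : ascent_pair s i \notin inversions s.
Proof. by rewrite mem_inversions !permKV [X in _ && X]ltnNge leqnSn andbF. Qed.

Lemma inversions_mul s i :
  ascent s i -> inversions (s * simple_refl i) = ascent_pair s i |: inversions s.
Proof.
move=> asc; apply/setP=> -[x y]; rewrite in_setU1 !mem_inversions !permM.
rewrite /ascent_pair xpair_eqE.
have [lt_xy|] /= := ltnP x y; last first.
  by rewrite orbF => le_yx; apply/esym/negbTE/negP=> /andP[/eqP Ex /eqP Ey];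
    rewrite Ex Ey leqNgt -/(ascent s i) asc in le_yx.
have [/andP[/eqP-> /eqP->]|ne_p] /= := boolP (_ && _).
  by rewrite !permKV simple_reflL simple_reflR letter_lt.
apply: simple_refl_lt; rewrite xpair_eqE.
  apply/negP=> /andP[/eqP Ey /eqP Ex]; move: lt_xy asc; rewrite /ascent -Ey -Ex !permK.
  by case: ltngtP.
by apply: contra ne_p => /andP[/eqP<- /eqP<-]; rewrite !permK !eqxx.
Qed.

Lemma card_inversions_mul s i :
  ascent s i -> #|inversions (s * simple_refl i)| = #|inversions s|.+1.
Proof. by move=> asc; rewrite inversions_mul // cardsU1 ascent_pairN. Qed.

Lemma card_inversions_descent s i :
  ~~ ascent s i -> #|inversions s| = #|inversions (s * simple_refl i)|.+1.
Proof.
by move=> des; rewrite -{1}(simple_reflK s i) card_inversions_mul // ascent_mul.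
Qed.

Lemma word_perm_rcons (w : seq 'I_n.-1) i :
  word_perm (rcons w i) = word_perm w * simple_refl i.
Proof. by rewrite /word_perm foldl_rcons. Qed.

(** Removing descents one at a time sorts [s] with one letter per inversion; conversely each letter
    of a word adds at most one inversion. *)
Lemma coxeter_lengthE s : coxeter_length s = #|inversions s|.
Proof.
rewrite /coxeter_length; case: ex_minnP => k /existsP[w /eqP <-] min_k.
apply/eqP; rewrite eqn_leq; apply/andP; split.
  apply: min_k; move Em: #|_| => m.
  elim: m {w k}(word_perm w) Em => [|m IHm] t Et.
    apply/existsP; exists [tuple]; rewrite /word_perm /=.
    apply/eqP/invg_inj; rewrite invg1; apply/esym/perm_increasing=> i.
    apply/negPn/negP=> des; have := card_inversions_descent des.
    by rewrite Et.
  have [/existsP[i des]|] := boolP [exists i, ~~ ascent t i].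
    have /existsP[w /eqP Ew] : has_word (t * simple_refl i) m.
      by apply: IHm; apply/eqP; rewrite -eqSS -card_inversions_descent // Et.
    apply/existsP; exists [tuple of rcons w i]; apply/eqP.
    by rewrite word_perm_rcons Ew simple_reflK.
  rewrite negb_exists => /forallP asc.
  suff /invg_inj t1 : t^-1 = 1^-1 by rewrite t1 inversions1 cards0 in Et.
  by rewrite invg1; apply: perm_increasing => i; apply/negPn/asc.
rewrite -[leqRHS](size_tuple w).
elim/last_ind: {w min_k}(tval w) => [|w i IHw].
  by rewrite /word_perm /= inversions1 cards0.
rewrite word_perm_rcons size_rcons.
have [asc|des] := boolP (ascent (word_perm w) i).
  by rewrite card_inversions_mul // ltnS.
by rewrite leqW // (leq_trans _ IHw) // (card_inversions_descent des).
Qed.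

Lemma in_DesL s i : (i \in DesL s) = ~~ ascent s i.
Proof.
rewrite inE !coxeter_lengthE /pcomp; have [asc|des] := boolP (ascent s i).
  by rewrite card_inversions_mul // ltnNge leqnSn.
by rewrite [ltnRHS](card_inversions_descent des) ltnSn.
Qed.

(** Apart from [i] itself, only the neighbours of [i] are affected by the swap, and there the
    ascents at [i] and [j] chain by transitivity into an ascent of the product. *)
Lemma DesL_mul s i j : i \notin DesL s ->
  j \in DesL (s * simple_refl i) -> j \notin DesL s -> j = i.
Proof.
rewrite !in_DesL !negbK /ascent invMg simple_reflV !permM.
move=> asc_i des asc_j; apply/eqP; move: des; apply: contraNT => ne_ji.
rewrite -val_eqE /= in ne_ji.
have sD x : x != i :> nat -> x != i.+1 :> nat -> simple_refl i x = x.
  by move=> xi xi1; apply/val_inj; rewrite /= simple_reflE !ifN.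
have [Ej|ne_j] := eqVneq (j : nat) i.+1.
  have El : letter_lo j = letter_hi i by apply/val_inj.
  rewrite El simple_reflR sD /= ?Ej ?gtn_eqF //.
  by apply: ltn_trans asc_i _; rewrite -El.
rewrite [simple_refl i (letter_lo j)]sD //.
have [Ej|ne_j1] := eqVneq j.+1 i.
  have Eh : letter_hi j = letter_lo i by apply/val_inj.
  by rewrite Eh simple_reflL; apply: ltn_trans asc_i; rewrite -Eh.
by rewrite sD.
Qed.

(** If no ascent pair of [s] were inverted by [t], then [s^-1 * t] would increase on all adjacent
    letters: at ascents of [s] by this assumption, at descents by the inclusion. It would be the
    identity. *)
Lemma inversions_sub_ascent s t :
    inversions s \subset inversions t -> s != t ->
  exists2 i, ascent s i & inversions (s * simple_refl i) \subset inversions t.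
Proof.
move=> /subsetP sub_st ne_st.
have [/existsP[i /andP[asc le_t]]|] :=
  boolP [exists i, ascent s i && (ascent_pair s i \in inversions t)].
  exists i => //; rewrite inversions_mul // subUset sub1set le_t.
  exact/subsetP.
rewrite negb_exists => /forallP none; case/eqP: ne_st.
apply/(mulgI s^-1); rewrite mulVg; apply/esym/perm_increasing=> i; rewrite !permM.
have := none i; rewrite negb_and mem_inversions /ascent.
have [asc /=|] := ltnP (s^-1 (letter_lo i)).
  rewrite -leqNgt leq_eqVlt => /orP[/eqP/val_inj/perm_inj E|//].
  by rewrite E ltnn in asc.
rewrite leq_eqVlt => /orP[/eqP/val_inj/perm_inj/eqP|des _].
  by rewrite eq_sym (negPf (letter_neq i)).
have /sub_st : (s^-1 (letter_hi i), s^-1 (letter_lo i)) \in inversions s.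
  by rewrite mem_inversions des !permKV letter_lt.
by rewrite mem_inversions => /andP[].
Qed.

Lemma weakL_coverP s t :
  reflect (exists2 i, ascent s i & t = s * simple_refl i) (weakL_cover s t).
Proof.
apply: (iffP existsP) => [[i /andP[]]|[i asc ->]].
  by rewrite in_DesL negbK => asc /eqP->; exists i.
by exists i; rewrite in_DesL negbK asc eqxx.
Qed.

Lemma weakLE s t : weakL s t = (inversions s \subset inversions t).
Proof.
apply/idP/idP=> [/connectP[p]|].
  elim: p s => /= [|u p IHp] s; first by move=> _ ->.
  case/andP=> /weakL_coverP[i asc ->] /IHp/[apply]; apply: subset_trans.
  by rewrite inversions_mul // subsetUr.
(* Climb from [s] to [t] by induction on the number of missing inversions. *)
move Em: (#|inversions t| - #|inversions s|) => m.
elim: m s Em => [|m IHm] s Em sub_st.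
  have [->|ne_st] := eqVneq s t; first exact: connect0.
  have [i asc /subset_leq_card] := inversions_sub_ascent sub_st ne_st.
  by rewrite card_inversions_mul // -subn_gt0 Em.
have [->|ne_st] := eqVneq s t; first exact: connect0.
have [i asc sub_t] := inversions_sub_ascent sub_st ne_st.
apply: (connect_trans (y := s * simple_refl i)).
  by apply/connect1/weakL_coverP; exists i.
by apply: IHm => //; rewrite card_inversions_mul // subnS Em.
Qed.

Lemma inversions_inj : injective inversions.
Proof.
move=> s t Est; apply/eqP/negPn/negP=> ne_st.
have := @inversions_sub_ascent s t; rewrite Est subxx.
case=> // i asc; rewrite -Est => /subset_leq_card.
by rewrite card_inversions_mul // ltnn.
Qed.

Lemma weakL_cover_eq s t i :
  ascent s i -> weakL s t -> weakL t (s * simple_refl i) -> t != s ->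
  t = s * simple_refl i.
Proof.
rewrite !weakLE => asc sub_st sub_t ne_ts; apply/inversions_inj/eqP.
rewrite eqEcard sub_t card_inversions_mul //.
rewrite proper_card // properEneq sub_st andbT eq_sym.
by apply: contraNneq ne_ts => /inversions_inj->.
Qed.

Lemma weakL_mul s i : ascent s i -> weakL s (s * simple_refl i).
Proof. by move=> asc; apply/connect1/weakL_coverP; exists i. Qed.

Lemma weakL_trans : transitive (@weakL n).
Proof. by move=> t s u; apply: connect_trans. Qed.

Lemma weakL_step s t : weakL s t -> s != t ->
  exists2 i, ascent s i & weakL (s * simple_refl i) t.
Proof.
rewrite weakLE => sub_st /(inversions_sub_ascent sub_st)[i asc sub_t].
by exists i; rewrite ?weakLE.
Qed.

End Inversions.

(** * Labeled posets and their linear extensions *)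

Section Posets.

Variable n : nat.
Implicit Types (s t u v : {perm 'I_n}) (P Q : labposet n) (i j : 'I_n.-1).
Implicit Types (x y z a b : 'I_n).

Lemma ple_refl P x : ple P x x.
Proof. by rewrite /ple; case: P => S /= /and3P[/forallP]. Qed.

Lemma ple_anti P x y : ple P x y -> ple P y x -> x = y.
Proof.
rewrite /ple; case: P => S /= /and3P[_ /'forall_forallP/(_ x y) anti _] xy yx.
by apply/eqP; move: anti; rewrite xy yx.
Qed.

Lemma ple_trans P y x z : ple P x y -> ple P y z -> ple P x z.
Proof.
rewrite /ple; case: P => S /= /and3P[_ _ /forallP/(_ x)].
by move=> /'forall_forallP/(_ y z)/implyP tr xy yz; apply: tr; rewrite xy.
Qed.

Lemma labposet_eq P Q : ple P =2 ple Q -> P = Q.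
Proof. by move=> PQ; apply/val_inj/setP=> -[x y]; apply: PQ. Qed.

Lemma ple_relabelV v P x y : ple (relabel v P) x y = ple P (v^-1 x) (v^-1 y).
Proof. by rewrite -{1}(permKV v x) -{1}(permKV v y) ple_relabel. Qed.

Lemma relabel1 P : relabel 1 P = P.
Proof. by apply: labposet_eq => x y; rewrite ple_relabelV invg1 !perm1. Qed.

Lemma relabelM s t P : relabel (s * t) P = relabel t (relabel s P).
Proof.
by apply: labposet_eq => x y; rewrite !ple_relabelV invMg !permM.
Qed.

Lemma SigmaLP P s :
  reflect (forall x y, ple P x y -> s x <= s y) (s \in SigmaL P).
Proof.
rewrite inE; apply: (iffP 'forall_forallP) => H x y; first exact/implyP.
exact/implyP/H.
Qed.

Lemma SigmaL_relabel v P s : (s \in SigmaL (relabel v P)) = (v * s \in SigmaL P).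
Proof.
apply/SigmaLP/SigmaLP => H x y.
  by rewrite -(ple_relabel v) !permM; apply: H.
by rewrite ple_relabelV => /H; rewrite !permM !permKV.
Qed.

(** The permutation sends a point to its rank, the number of points with smaller key. *)
Lemma perm_of_key (K : 'I_n -> nat) : injective K ->
  exists s : {perm 'I_n}, forall x y, (s x < s y) = (K x < K y).
Proof.
move=> K_inj; pose below x := [set z | K z < K x].
have ltn_below x : #|below x| < n.
  rewrite -[ltnRHS]card_ord -cardsT proper_card // properE subsetT /=.
  by apply/subsetPn; exists x; rewrite ?inE ?ltnn.
have below_lt x y : (#|below x| < #|below y|) = (K x < K y).
  have sub z w : K z <= K w -> below z \subset below w.
    by move=> le_zt; apply/subsetP=> t; rewrite !inE => /leq_trans; apply.
  have [lt_xy|le_yx] := ltnP (K x) (K y); last first.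
    by apply/negbTE; rewrite -leqNgt subset_leq_card ?sub.
  apply: proper_card; rewrite properE (sub _ _ (ltnW lt_xy)) andTb.
  by apply/subsetPn; exists x; rewrite inE ?ltnn.
pose f x := Ordinal (ltn_below x).
have f_inj : injective f.
  move=> x y /(congr1 val) /= Exy; apply: K_inj.
  by apply/eqP; move: (below_lt x y) (below_lt y x); rewrite Exy ltnn; case: ltngtP.
by exists (perm f_inj) => x y; rewrite !permE /= below_lt.
Qed.

(* Refining a weakly monotone key by the size of principal ideals makes it
   strictly monotone; the label only breaks the remaining ties. *)
Lemma linear_extension P (K : 'I_n -> nat) :
    (forall x y, ple P x y -> K x <= K y) ->
  exists2 s, s \in SigmaL P & forall x y, K x < K y -> s x < s y.
Proof.
move=> K_mono; pose ideal x := [set z | ple P z x].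
have ideal_le x : #|ideal x| <= n by rewrite -[leqRHS]card_ord max_card.
pose L x := (K x * n.+1 + #|ideal x|) * n + x.
have L_lt x y : K x * n.+1 + #|ideal x| < K y * n.+1 + #|ideal y| -> L x < L y.
  move=> lt_xy; apply: leq_trans (leq_addr _ _); apply: leq_trans (leq_mul lt_xy (leqnn n)).
  by rewrite mulSnr ltn_add2l.
have L_inj : injective L.
  move=> x y; rewrite /L => /(congr1 (modn^~ n)).
  by rewrite !modnMDl !modn_small // => /val_inj.
have [s sL] := perm_of_key L_inj; exists s => [|x y lt_xy]; last first.
  rewrite sL L_lt //; apply: leq_trans (leq_addr _ _).
  by apply: leq_trans (leq_mul lt_xy (leqnn _)); rewrite mulSnr ltn_add2l ltnS.
apply/SigmaLP=> x y le_xy; have [->//|ne_xy] := eqVneq x y.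
apply: ltnW; rewrite sL L_lt // -addnS leq_add ?leq_mul ?K_mono //.
apply: proper_card; rewrite properE; apply/andP; split.
  by apply/subsetP=> z; rewrite !inE => /ple_trans; apply.
apply/subsetPn; exists y; rewrite inE ?ple_refl //.
by apply: contraNN ne_xy => /(ple_anti le_xy)->.
Qed.

Lemma ple_SigmaL P x y :
  reflect (forall s, s \in SigmaL P -> s x <= s y) (ple P x y).
Proof.
apply: (iffP idP) => [le_xy s /SigmaLP|le_s]; first exact.
apply/negPn/negP=> not_le.
(* The key is 0 on the principal ideal of [y] and 1 off it, so the extension puts [y] before [x]. *)
have [|s /le_s + ltK] := @linear_extension P (fun z => ~~ ple P z y).
  move=> w z le_wz; case: (boolP (ple P z y)) => [le_zy|_]; last exact: leq_b1.
  by rewrite (ple_trans le_wz).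
by rewrite leqNgt ltK // ple_refl not_le.
Qed.

Lemma SigmaL_inj : injective (@SigmaL n).
Proof.
by move=> P Q E; apply: labposet_eq => x y; apply/ple_SigmaL/ple_SigmaL; rewrite E.
Qed.

Lemma pcoversP P x y :
  reflect [/\ x != y, ple P x y & forall z, ple P x z -> ple P z y -> z = x \/ z = y]
          (pcovers P x y).
Proof.
rewrite /pcovers /plt -andbA.
apply: (iffP and3P) => -[ne le_xy H]; split=> //.
  move=> z xz zy; have [->|ne_zx] := eqVneq z x; first by left.
  have [->|ne_zy] := eqVneq z y; first by right.
  by case/existsP: H; exists z; rewrite eq_sym ne_zx xz ne_zy.
apply/existsP=> -[z /andP[/andP[xz lexz] /andP[zy lezy]]].
by case: (H z) => // E; rewrite E eqxx in xz zy.
Qed.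

Lemma adjacent_extension P a b :
    a != b -> ~~ ple P b a -> ~~ ple P a b || pcovers P a b ->
  exists2 s, s \in SigmaL P & s b = (s a).+1 :> nat.
Proof.
move=> ne_ab nle_ba ab_cov.
have between z : ple P a z -> ple P z b -> z = a \/ z = b.
  move=> az zb; case/orP: ab_cov => [|/pcoversP[_ _]]; last exact.
  by rewrite (ple_trans az zb).
(* Layers: first everything below [a] or [b], then [a], then [b], then the rest. This is monotone
   because [b] is not below [a] and nothing lies strictly between them. *)
pose K z := if z == a then 1%N else if z == b then 2 else
            if ple P z a || ple P z b then 0 else 3.
have Ka : K a = 1%N by rewrite /K eqxx.
have Kb : K b = 2 by rewrite /K eq_sym (negPf ne_ab) eqxx.
have K12 z : 1 <= K z <= 2 -> z = a \/ z = b.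
  by rewrite /K; case: eqVneq => [|_]; [left|case: eqVneq => [|_]; [right|case: ifP]].
have [z w le_zw|s sP ltK] := @linear_extension P K.
  have [->//|ne_zw] := eqVneq z w.
  have [Ea|nwa] := eqVneq w a.
    rewrite Ea in le_zw ne_zw *; rewrite Ka /K (negPf ne_zw) le_zw.
    by case: eqVneq => // Eb; rewrite -Eb le_zw in nle_ba.
  have [Eb|nwb] := eqVneq w b.
    rewrite Eb in le_zw ne_zw *; rewrite Kb /K (negPf ne_zw) le_zw orbT.
    by case: ifP.
  rewrite [K w]/K (negPf nwa) (negPf nwb).
  case: ifP => [/orP[]wab|_]; last by rewrite /K; do 3 case: ifP => //.
    have zab : ple P z a by apply: ple_trans wab.
    rewrite /K zab; case: eqVneq => [Ea|_].
      by rewrite -Ea in wab nwa; rewrite (ple_anti wab le_zw) eqxx in nwa.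
    case: eqVneq => // Eb; by rewrite -Eb zab in nle_ba.
  have zab : ple P z b by apply: ple_trans wab.
  rewrite /K zab orbT; case: eqVneq => [Ea|_].
    by rewrite Ea in le_zw; case: (between w) => // E; rewrite E eqxx in nwa nwb.
  case: eqVneq => // Eb; rewrite -Eb in wab nwb.
  by rewrite (ple_anti wab le_zw) eqxx in nwb.
exists s => //; apply/eqP; rewrite eqn_leq ltK ?Ka ?Kb // andbT leqNgt.
apply/negP=> lt_ab.
(* In a gap between [a] and [b], the point with value [(s a).+1] would have key 1 or 2, hence be [a]
   or [b]. *)
have lt_n : (s a).+1 < n by apply: ltn_trans (ltn_ord (s b)).
pose z := s^-1 (Ordinal lt_n).
have sz : s z = (s a).+1 :> nat by rewrite /z permKV.
have [|E|E] := K12 z; try by rewrite E in sz; lia.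
apply/andP; split; rewrite leqNgt; apply/negP.
  by rewrite -[X in _ < X]Ka => /ltK; rewrite sz; lia.
by rewrite -[X in X < _]Kb => /ltK; rewrite sz; lia.
Qed.

End Posets.

(** * Swapping the labels of comparable pairs that are not covers *)

Section CoveringPairs.

Variable n : nat.
Implicit Types (s t u v : {perm 'I_n}) (P Q : labposet n) (i j : 'I_n.-1).
Implicit Types (x y z a b : 'I_n) (w : seq 'I_n.-1).

Lemma pcomparable_relabel v P a b :
  pcomparable (relabel v P) (v a) (v b) = pcomparable P a b.
Proof. by rewrite /pcomparable !ple_relabel. Qed.

Lemma pcovers_relabel v P a b : pcovers (relabel v P) (v a) (v b) = pcovers P a b.
Proof.
rewrite /pcovers /plt !(inj_eq perm_inj) ple_relabel; congr (_ && ~~ _).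
apply/existsP/existsP=> -[z Hz]; last first.
  by exists (v z); rewrite !(inj_eq perm_inj) !ple_relabel.
by exists (v^-1 z); move: Hz; rewrite -{1 2 3 4}(permKV v z) !(inj_eq perm_inj) !ple_relabel.
Qed.

Lemma comparable_noncover_relabel v P a b :
  comparable_noncover (relabel v P) (v a) (v b) = comparable_noncover P a b.
Proof. by rewrite /comparable_noncover pcomparable_relabel !pcovers_relabel. Qed.

Lemma comparable_noncoverC P a b :
  comparable_noncover P a b = comparable_noncover P b a.
Proof.
by rewrite /comparable_noncover /pcomparable orbC; congr (_ && _); rewrite andbC.
Qed.

(** An element strictly between the two in [P] is also placed strictly between them by every linear
    extension. *)
Lemma comparable_noncover_nadjacent P a b s :
    a != b -> comparable_noncover P a b -> s \in SigmaL P ->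
  s b <> (s a).+1 :> nat.
Proof.
move=> ne_ab /and3P[comp ncov_ab ncov_ba] /SigmaLP sP Esb.
have le_ab : ple P a b.
  by case/orP: comp => // /sP; rewrite Esb ltnn.
move: ncov_ab; rewrite /pcovers /plt ne_ab le_ab /= negbK.
case/existsP=> z /andP[/andP[ne_az /sP az] /andP[ne_zb /sP zb]].
have: (s a < s z < s b)%N.
  by rewrite !ltn_neqAle az zb !(inj_eq val_inj) !(inj_eq perm_inj) ne_az ne_zb.
by rewrite Esb ltnS => /andP[/leq_trans/[apply]]; rewrite ltnn.
Qed.

Lemma adjacent_extension_noncover P a b :
    a != b -> ~~ comparable_noncover P a b ->
  exists2 s, s \in SigmaL P & s b = (s a).+1 :> nat \/ s a = (s b).+1 :> nat.
Proof.
move=> ne_ab nc; suff [[]|[]] : (~~ ple P b a /\ (~~ ple P a b || pcovers P a b)) \/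
                 (~~ ple P a b /\ (~~ ple P b a || pcovers P b a)).
- by move=> /(adjacent_extension ne_ab)/[apply] -[s]; exists s; auto.
- rewrite eq_sym in ne_ab.
  by move=> /(adjacent_extension ne_ab)/[apply] -[s]; exists s; auto.
have cov_lt x y : pcovers P x y -> ple P x y by case/pcoversP.
have anti : ~~ (ple P a b && ple P b a).
  by apply: contraNN ne_ab => /andP[/ple_anti/[apply]->].
move: nc anti (cov_lt a b) (cov_lt b a).
rewrite /comparable_noncover /pcomparable.
case: (ple P a b) (ple P b a) (pcovers P a b) (pcovers P b a)
  => [] [] [] [] //= *; by [left | right | auto].
Qed.

(** The condition on [w] in the theorem, in a form suited to induction on the word;
    [admissible_tnth] translates between the two. *)
Fixpoint admissible P w : bool :=
  if w is j :: w' then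
    comparable_noncover P (letter_lo j) (letter_hi j)
      && admissible (relabel (simple_refl j) P) w'
  else true.

Lemma word_perm_cons j w : word_perm (j :: w) = simple_refl j * word_perm w.
Proof. by rewrite !word_perm_prod big_cons. Qed.

Lemma admissible_nth P w i0 :
  admissible P w <->
  forall k, k < size w ->
    comparable_noncover (relabel (word_perm (take k w)) P)
      (letter_lo (nth i0 w k)) (letter_hi (nth i0 w k)).
Proof.
elim: w P => [|j w IHw] P /=; first by [].
split=> [/andP[cn /IHw adm] [_|k ltk]|H].
- by rewrite /= relabel1.
- by rewrite /= word_perm_cons relabelM; apply: adm.
apply/andP; split; first by move: (H 0 isT); rewrite /= relabel1.
apply/IHw => k ltk; have := H k.+1 ltk.
by rewrite /= word_perm_cons relabelM.
Qed.

Lemma admissible_tnth P r (w : r.-tuple 'I_n.-1) :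
  admissible P w <->
  forall k : 'I_r,
    comparable_noncover (relabel (word_perm (take k w)) P)
      (letter_lo (tnth w k)) (letter_hi (tnth w k)).
Proof.
case: r w => [|r] w; first by rewrite tuple0; split=> // _ [].
have i0 := tnth w ord0.
split=> [/(admissible_nth _ _ i0) adm k|adm].
  by rewrite (tnth_nth i0); apply: adm; rewrite size_tuple.
apply/(admissible_nth _ _ i0) => k; rewrite size_tuple => ltk.
by have := adm (Ordinal ltk); rewrite (tnth_nth i0).
Qed.

(** Exchanging the positions [j] and [j.+1] keeps the order of every other pair of positions; on
    this pair [s] and [t] agree by hypothesis. *)
Lemma inversions_simple_subset s t j :
    (s (letter_lo j) < s (letter_hi j)) = (t (letter_lo j) < t (letter_hi j)) ->
    inversions s \subset inversions t ->
  inversions (simple_refl j * s) \subset inversions (simple_refl j * t).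
Proof.
move=> same /subsetP sub; apply/subsetP=> -[x y].
rewrite !mem_inversions !permM => /andP[lt_xy lt_s]; rewrite lt_xy /=.
have [[Ex Ey]|ne_xy] := eqVneq (x, y) (letter_lo j, letter_hi j).
  by move: lt_s; rewrite Ex Ey simple_reflL simple_reflR same.
have lt_sxy : simple_refl j x < simple_refl j y.
  rewrite simple_refl_lt // xpair_eqE; apply/negP=> /andP[/eqP Ex /eqP Ey].
  by move: lt_xy; rewrite Ex Ey ltnNge ltnW // letter_lt.
have /sub : (simple_refl j x, simple_refl j y) \in inversions s.
  by rewrite mem_inversions lt_sxy.
by rewrite mem_inversions => /andP[].
Qed.

Lemma perm_ltnNge s x y : x != y -> (s x < s y) = ~~ (s y < s x).
Proof. by move=> ne; rewrite -leqNgt ltn_neqAle (inj_eq val_inj) (inj_eq perm_inj) ne. Qed.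

Lemma comparable_noncover_descent_equiv P j :
    comparable_noncover P (letter_lo j) (letter_hi j) ->
  descent_equiv (SigmaL P) (SigmaL (relabel (simple_refl j) P)).
Proof.
move=> cn; exists (mulg (simple_refl j)); split.
- by move=> s t _ _; apply: mulgI.
- apply/setP=> s; rewrite SigmaL_relabel; apply/imsetP/idP=> [[t tP ->]|sP].
    by rewrite mulgA tperm2 mul1g.
  by exists (simple_refl j * s); rewrite // mulgA tperm2 mul1g.
(* Comparability of the two labels makes all linear extensions order them alike. *)
- have same s t : s \in SigmaL P -> t \in SigmaL P ->
    (s (letter_lo j) < s (letter_hi j)) = (t (letter_lo j) < t (letter_hi j)).
    move=> /SigmaLP sP /SigmaLP tP.
    have lt_neq u : (u (letter_lo j) < u (letter_hi j)) =
        (u (letter_lo j) <= u (letter_hi j)).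
      by rewrite ltn_neqAle (inj_eq val_inj) (inj_eq perm_inj) letter_neq.
    case/and3P: cn => /orP[] le _ _; first by rewrite !lt_neq sP ?tP.
    by rewrite !ltnNge sP ?tP.
  move=> s t sP tP; rewrite !weakLE; apply/idP/idP; last first.
    by apply: inversions_simple_subset; apply: same.
  (* Translation by [simple_refl j] is an involution, so the same lemma applied to the translated
     permutations gives the other direction. *)
  move=> sub; have := fun same => @inversions_simple_subset _ _ j same sub.
  rewrite !mulgA !tperm2 !mul1g !permM simple_reflL simple_reflR; apply.
  by rewrite [LHS]perm_ltnNge ?[RHS]perm_ltnNge ?(same s t) // eq_sym letter_neq.
move=> s sP; apply/setP=> i; rewrite !in_DesL /ascent invMg simple_reflV !permM.
(* A descent could change only if the values [i] and [i.+1] sat at the two swapped labels, which are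
   never adjacent in value. *)
rewrite simple_refl_lt // xpair_eqE; apply/negP=> /andP[/eqP El /eqP Eh].
  apply: (comparable_noncover_nadjacent (letter_neq j) cn sP).
  by rewrite -El -Eh !permKV.
rewrite comparable_noncoverC in cn; have := letter_neq j; rewrite eq_sym => ne.
by apply: (comparable_noncover_nadjacent ne cn sP); rewrite -El -Eh !permKV.
Qed.

Lemma descent_equiv_refl (I : {set {perm 'I_n}}) : descent_equiv I I.
Proof. by exists id; split=> //; rewrite imset_id. Qed.

Lemma descent_equiv_trans (I J K : {set {perm 'I_n}}) :
  descent_equiv I J -> descent_equiv J K -> descent_equiv I K.
Proof.
move=> [f [f_inj f_im f_mono f_des]] [g [g_inj g_im g_mono g_des]].
have fJ s : s \in I -> f s \in J by move=> sI; rewrite -f_im imset_f.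
exists (g \o f); split.
- by move=> s t sI tI /g_inj E; apply: f_inj => //; apply: E; apply: fJ.
- by rewrite imset_comp f_im.
- by move=> s t sI tI; rewrite /= g_mono ?fJ ?f_mono.
by move=> s sI; rewrite f_des // g_des ?fJ.
Qed.

Lemma admissible_descent_equiv P w :
  admissible P w -> descent_equiv (SigmaL P) (SigmaL (relabel (word_perm w) P)).
Proof.
elim: w P => [|j w IHw] P /=.
  by rewrite relabel1 => _; apply: descent_equiv_refl.
case/andP=> cn /IHw; rewrite word_perm_cons relabelM.
exact/descent_equiv_trans/comparable_noncover_descent_equiv.
Qed.

(** Bubble sort: swap some [j] with [v] decreasing at [j]. The remaining inversions come from
    inversions of [v] through [simple_refl j], so they are still comparable pairs and not covers in
    the relabeled poset. *)
Lemma admissible_exists P v :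
    (forall a b, a < b -> v b < v a -> comparable_noncover P a b) ->
  exists2 w, v = word_perm w & admissible P w.
Proof.
(* The inverse appears because [ascent v^-1 j] compares the values of [v] at the letters [j] and
   [j.+1]. *)
move Em: #|inversions v^-1| => m; elim: m v P Em => [|m IHm] v P Em cn.
  exists [::] => //; rewrite [RHS]/word_perm /=; apply: perm_increasing => j.
  apply/negPn/negP=> des; suff /card_inversions_descent : ~~ ascent v^-1 j.
    by rewrite Em.
  by rewrite /ascent invgK.
have [/existsP[j des]|] := boolP [exists j, ~~ ascent v^-1 j]; last first.
  rewrite negb_exists => /forallP asc.
  suff v1 : v = 1 by rewrite v1 invg1 inversions1 cards0 in Em.
  by apply: perm_increasing => j; have := asc j; rewrite negbK /ascent invgK.
have lt_v : v (letter_hi j) < v (letter_lo j).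
  move: des; rewrite /ascent invgK -leqNgt leq_eqVlt => /orP[|//].
  by rewrite (inj_eq val_inj) (inj_eq perm_inj) eq_sym (negPf (letter_neq j)).
have [||w Ev adm] := IHm (simple_refl j * v) (relabel (simple_refl j) P).
- rewrite invMg simple_reflV; apply/eqP.
  by rewrite -eqSS -card_inversions_descent ?Em.
- move=> a b lt_ab; rewrite !permM => lt_vs.
  rewrite -[a](tpermK (letter_lo j) (letter_hi j)) -[b](tpermK (letter_lo j) (letter_hi j)).
  rewrite comparable_noncover_relabel; apply: cn => //.
  rewrite simple_refl_lt // xpair_eqE; apply/negP=> /andP[/eqP Ea /eqP Eb].
    by move: lt_vs; rewrite Ea Eb simple_reflL simple_reflR ltnNge ltnW.
  by move: lt_ab; rewrite Ea Eb ltnNge ltnW // letter_lt.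
exists (j :: w); first by rewrite word_perm_cons -Ev mulgA tperm2 mul1g.
by rewrite /= adm andbT cn ?letter_lt.
Qed.

End CoveringPairs.

(** * Weak order intervals and their regular posets *)

Section Intervals.

Variable n : nat.
Implicit Types (s t u v c : {perm 'I_n}) (P Q : labposet n) (i j : 'I_n.-1).
Implicit Types (x y z a b : 'I_n) (I J : {set {perm 'I_n}}).

Lemma IntP I : I \in Int n -> exists s t, weakL s t /\ I = weak_interval s t.
Proof.
rewrite inE => /andP[/set0Pn[u] uI /existsP[s /existsP[t /eqP E]]].
exists s, t; split=> //; move: uI; rewrite E inE => /andP[].
exact: weakL_trans.
Qed.

Lemma Int_convex I s t u :
  I \in Int n -> s \in I -> t \in I -> weakL s u -> weakL u t -> u \in I.
Proof.
move=> /IntP[a [b [_ ->]]]; rewrite !inE => /andP[a_s _] /andP[_ tb] su ut.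
by rewrite (weakL_trans a_s su) (weakL_trans ut tb).
Qed.

(** The intersection of the linear orders [s] and [t]. For [weakL s t] it is a regular poset of the
    interval, which gives existence in the Björner-Wachs theorem. *)
Definition common_order s t : {set 'I_n * 'I_n} :=
  [set p : 'I_n * 'I_n | (s p.1 <= s p.2) && (t p.1 <= t p.2)].

Lemma common_order_porder s t : is_porder (common_order s t).
Proof.
apply/and3P; split.
- by apply/forallP=> x; rewrite inE /= !leqnn.
- apply/'forall_forallP=> x y; rewrite !inE /=.
  apply/implyP=> /andP[/andP[sxy _] /andP[syx _]].
  by apply/eqP/(@perm_inj _ s)/val_inj/eqP; rewrite eqn_leq sxy.
apply/forallP=> x; apply/'forall_forallP=> y z; rewrite !inE /=.
apply/implyP=> /andP[/andP[sxy txy] /andP[syz tyz]].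
by rewrite (leq_trans sxy syz) (leq_trans txy tyz).
Qed.

Definition common_poset s t := LabPoset (common_order_porder s t).

Lemma ple_common s t x y :
  ple (common_poset s t) x y = (s x <= s y) && (t x <= t y).
Proof. by rewrite /ple inE. Qed.

(** Thus the common order is decided by [t] alone on pairs with increasing labels and, by
    [weakL_gt], by [s] alone on pairs with decreasing labels. *)
Lemma weakL_lt s t x y : weakL s t -> x < y -> t x <= t y -> s x <= s y.
Proof.
rewrite weakLE => /subsetP/(_ (x, y)); rewrite !mem_inversions => + lt_xy.
rewrite lt_xy /= => sub; rewrite leqNgt [s x <= s y]leqNgt.
exact: contraNN.
Qed.

Lemma weakL_gt s t x y : weakL s t -> y < x -> s x <= s y -> t x <= t y.
Proof.
move=> le_st lt_yx le_s; rewrite leqNgt; apply/negP=> /ltnW/(weakL_lt le_st lt_yx).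
move=> ge_s; have /perm_inj E : s x = s y by apply/val_inj/eqP; rewrite eqn_leq le_s.
by rewrite E ltnn in lt_yx.
Qed.

(** Relations with decreasing labels force the inversions of [s]; those with increasing labels
    forbid inversions outside [t]. *)
Lemma SigmaL_common s t : weakL s t -> SigmaL (common_poset s t) = weak_interval s t.
Proof.
move=> le_st; apply/setP=> u; rewrite inE [in RHS]inE; apply/idP/andP.
  move=> /'forall_forallP uP.
  have {}uP x y : s x <= s y -> t x <= t y -> u x <= u y.
    by move=> sxy txy; apply: (implyP (uP x y)); rewrite ple_common sxy.
  rewrite !weakLE; split; apply/subsetP=> -[x y]; rewrite !mem_inversions.
    move=> /andP[lt_xy lt_s]; rewrite lt_xy /= ltn_neqAle (inj_eq val_inj).
    rewrite (inj_eq perm_inj) -val_eqE /= gtn_eqF //=.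
    by apply: uP; [apply: ltnW|apply: weakL_gt (ltnW lt_s)].
  move=> /andP[lt_xy lt_u]; rewrite lt_xy /= ltnNge.
  apply: contraTN lt_u => le_t; rewrite -leqNgt.
  by apply: uP => //; apply: weakL_lt le_t.
case=> su ut; apply/'forall_forallP=> x y; rewrite ple_common.
apply/implyP=> /andP[sxy txy]; case: (ltngtP x y) => [lt_xy|lt_yx|/val_inj-> //].
  exact: weakL_lt txy.
exact: weakL_gt sxy.
Qed.

(** One linear order decides each case: in it [y] comes after [x], or before [x] and hence before
    [z]. *)
Lemma regular_common s t : weakL s t -> regular (common_poset s t).
Proof.
move=> le_st; apply/forallP=> x; apply/'forall_forallP=> y z.
rewrite !ple_common; apply/implyP=> /andP[/andP[sxz txz] bt].
case/orP: bt => /andP[lt1 lt2].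
  have [txy|tyx] := leqP (t x) (t y); first by rewrite (weakL_lt le_st lt1 txy).
  have tyz := leq_trans (ltnW tyx) txz.
  by rewrite (weakL_lt le_st lt2 tyz) tyz orbT.
have [sxy|syx] := leqP (s x) (s y); first by rewrite (weakL_gt le_st lt2 sxy).
have syz := leq_trans (ltnW syx) sxz.
by rewrite syz (weakL_gt le_st lt1 syz) orbT.
Qed.

Lemma SigmaL_poset_of_interval I :
  I \in Int n -> SigmaL (poset_of_interval I) = I.
Proof.
move=> /IntP[s [t [le_st EI]]]; rewrite /poset_of_interval.
case: pickP => [P /andP[_ /eqP] //|/(_ (common_poset s t))].
by rewrite regular_common // SigmaL_common // EI eqxx.
Qed.

(** * Descent-preserving isomorphisms are translations *)

Section DescentIsomorphism.

Variables (I J : {set {perm 'I_n}}) (f : {perm 'I_n} -> {perm 'I_n}).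
Hypotheses (IntI : I \in Int n) (IntJ : J \in Int n).
Hypotheses (f_inj : {in I &, injective f}) (f_im : f @: I = J).
Hypothesis f_mono : {in I &, {mono f : s t / weakL s t}}.
Hypothesis f_des : {in I, forall s, DesL s = DesL (f s)}.

(* The image of a cover is a cover, and its label is the only descent which is
   gained along it. *)
Lemma descent_iso_cover s i :
  s \in I -> s * simple_refl i \in I -> ascent s i ->
  f (s * simple_refl i) = f s * simple_refl i.
Proof.
move=> sI s'I asc; have fJ u : u \in I -> f u \in J by rewrite -f_im; apply: imset_f.
have neq u j : u != u * simple_refl j.
  rewrite -{1}(mulg1 u) (inj_eq (mulgI u)); apply: contraNneq (letter_neq j).
  by move=> E; rewrite -(perm1 (letter_hi j)) E simple_reflR.
have le_f : weakL (f s) (f (s * simple_refl i)) by rewrite f_mono ?weakL_mul.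
have [|k asc_k le_k] := weakL_step le_f.
  by apply: contraNN (neq s i) => /eqP E; apply/eqP/f_inj.
have: f s * simple_refl k \in J.
  exact: (Int_convex IntJ (fJ _ sI) (fJ _ s'I) (weakL_mul asc_k)).
rewrite -f_im => /imsetP[u uI Eu].
have Eus : u = s * simple_refl i.
  apply: weakL_cover_eq => //.
  - by rewrite -f_mono // -Eu weakL_mul.
  - by rewrite -f_mono // -Eu.
  by apply: contraNneq (neq (f s) k) => Es; rewrite Eu Es.
rewrite -Eus -Eu; congr (_ * simple_refl _).
apply: (@DesL_mul _ s); rewrite ?in_DesL ?negbK //.
  by rewrite -in_DesL -Eus f_des // -Eu in_DesL ascent_mul asc_k.
by rewrite -[ascent s k]negbK -in_DesL f_des // in_DesL negbK.
Qed.

(** Each cover step multiplies [s] and [f s] on the right by the same letter, so [f s * s^-1] is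
    constant along a saturated chain. *)
Lemma descent_iso_le s t :
  s \in I -> t \in I -> weakL s t -> f t = f s * s^-1 * t.
Proof.
move Em: (#|inversions t| - #|inversions s|) => m.
elim: m s Em => [|m IHm] s Em sI tI le_st.
  have [->|ne_st] := eqVneq s t; first by rewrite mulgKV.
  have [i asc] := weakL_step le_st ne_st.
  by rewrite weakLE => /subset_leq_card; rewrite card_inversions_mul // -subn_gt0 Em.
have [->|ne_st] := eqVneq s t; first by rewrite mulgKV.
have [i asc le_t] := weakL_step le_st ne_st.
have s'I : s * simple_refl i \in I.
  exact: (Int_convex IntI sI tI (weakL_mul asc)).
rewrite (IHm (s * simple_refl i)) ?card_inversions_mul ?subnS ?Em //.
by rewrite descent_iso_cover // invMg !mulgA mulgK.
Qed.

Lemma descent_iso_mul : exists c, {in I, forall s, f s = c * s}.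
Proof.
(* Every element lies above the minimum [a], so the constant can be read off there. *)
have /IntP[a [b [le_ab EI]]] := IntI; exists (f a * a^-1) => s sI.
have aI : a \in I by rewrite EI inE le_ab andbT weakLE.
by apply: descent_iso_le => //; move: sI; rewrite EI inE => /andP[].
Qed.

End DescentIsomorphism.

(** Otherwise some extension [s] gives [a] and [b] consecutive values. The descent test at these
    values compares [a] with [b] for [s], and [v a] with [v b] for [v^-1 * s]. *)
Lemma descent_mul_comparable_noncover P v a b :
    {in SigmaL P, forall s, DesL s = DesL (v^-1 * s)} ->
  a < b -> v b < v a -> comparable_noncover P a b.
Proof.
move=> des lt_ab lt_v; apply/negPn/negP=> nc.
have ne_ab : a != b by rewrite -val_eqE neq_ltn lt_ab.
have [s sP adj] := adjacent_extension_noncover ne_ab nc.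
have key x y : s y = (s x).+1 :> nat -> (x < y) = (v x < v y).
  move=> Ey; have lti : s x < n.-1 by have := ltn_ord (s y); rewrite Ey; lia.
  pose i := Ordinal lti.
  have Ex : s x = letter_lo i by apply/val_inj.
  have {}Ey : s y = letter_hi i by apply/val_inj.
  have := congr1 (fun D : {set 'I_n.-1} => i \notin D) (des s sP).
  by rewrite !in_DesL !negbK /ascent -Ex -Ey invMg invgK !permM !permK.
by case: adj => /key; rewrite ?lt_ab ?lt_v // ltnNge ltnW // => /esym; rewrite ltnNge ltnW.
Qed.

End Intervals.

Theorem theorem3p8 (n : nat) (hn : 0 < n) (I J : {set {perm 'I_n}})
    (hI : I \in Int n) (hJ : J \in Int n) :
  descent_equiv I J <->
  exists (r : nat) (w : r.-tuple 'I_n.-1),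
    poset_of_interval J = relabel (word_perm w) (poset_of_interval I) /\
    forall k : 'I_r,
      comparable_noncover
        (relabel (word_perm (take k w)) (poset_of_interval I))
        (letter_lo (tnth w k)) (letter_hi (tnth w k)).
Proof.
have [EI EJ] := (SigmaL_poset_of_interval hI, SigmaL_poset_of_interval hJ).
split=> [[f [f_inj f_im f_mono f_des]]|[r [w [EP /admissible_tnth adm]]]]; last first.
  by rewrite -EI -EJ EP; apply: admissible_descent_equiv.
have [c f_mul] := descent_iso_mul hI hJ f_inj f_im f_mono f_des.
(* As [f] is [s] to [c * s], the relabeling permutation [v] is [c^-1]. *)
have [|w Ec adm] := @admissible_exists _ (poset_of_interval I) c^-1.
  move=> a b; apply: descent_mul_comparable_noncover => s; rewrite EI invgK => sI.
  by rewrite f_des // f_mul.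
exists (size w), (in_tuple w); split; last exact/admissible_tnth.
(* The two posets are compared through their linear extensions: both sets are the image of [I] under
   [f]. *)
rewrite -Ec; apply: SigmaL_inj; apply/setP=> s.
rewrite SigmaL_relabel EI EJ -f_im; apply/imsetP/idP=> [[t tI ->]|sI].
  by rewrite f_mul // mulKg.
by exists (c^-1 * s); rewrite // f_mul // mulKVg.
Qed.
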